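(* Every forest is contractible.
   Context: All graphs are finite and simple (no loops or multiple edges). Let $G$ and $H$ be graphs with $V(H)\subseteq V(G)$. An $H$-scheme in $G$ is a collection of paths $\{P_{uv}: uv\in E(H)\}$ such that (1) each $P_{uv}$ is a $u,v$-path in $G$ with $V(P_{uv})\cap V(H)=\{u,v\}$, and (2) whenever $e_1,\dots,e_k\in E(H)$ satisfy $V(P_{e_1})\cap\dots\cap V(P_{e_k})\neq\emptyset$, there is a vertex $u\in V(H)$ incident with each of $e_1,\dots,e_k$. $G$ has a rooted $H$-minor if there are pairwise vertex-disjoint connected subgraphs $C_v$ of $G$, one for each $v\in V(H)$, such that $v\in V(C_v)$ for all $v\in V(H)$ and for each edge $uv\in E(H)$ there is an edge of $G$ joining $C_u$ and $C_v$. A graph $H$ is contractible if every graph $G$ with $V(H)\subseteq V(G)$ that contains an $H$-scheme has a rooted $H$-minor. *)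

(* Defs.v *)
From mathcomp Require Import all_boot.

Set Implicit Arguments.
Unset Strict Implicit.
Unset Printing Implicit Defensive.

Record sgraph := SGraph {
  vertex :> finType;
  adj : rel vertex;
  adj_sym : symmetric adj;
  adj_irrefl : irreflexive adj
}.

Definition edges (G : sgraph) : {set {set G}} :=
  [set e : {set G} | [exists x, exists y, adj x y && (e == [set x; y])]].

Definition forest (G : sgraph) : Prop :=
  forall s : seq G, 2 < size s -> ~ ucycle (@adj G) s.

Record subgraph (G : sgraph) := Subgraph {
  sub_vertex : {set G};
  sub_adj : rel G;
  sub_adj_sym : symmetric sub_adj;
  sub_adj_vertex : forall x y, sub_adj x y ->
    x \in sub_vertex /\ y \in sub_vertex;
  sub_adj_adj : forall x y, sub_adj x y -> adj x y
}.

Definition connected (G : sgraph) (C : subgraph G) : Prop :=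
  sub_vertex C != set0 /\
  {in sub_vertex C &, forall x y, connect (sub_adj C) x y}.

(* [p] lists, in order from [x] to [y], the vertices of a path of [G]. *)
Definition path_from_to (G : sgraph) (x y : G) (p : seq G) : Prop :=
  exists q : seq G,
    [/\ p = x :: q, path (@adj G) x q, uniq p & last x q = y].

(* Paths are undirected: an [x,y]-path may be listed from either end. *)
Definition path_between (G : sgraph) (x y : G) (p : seq G) : Prop :=
  path_from_to x y p \/ path_from_to y x p.

(* The inclusion of V(H) in V(G) is represented by an injection
   [f : H -> G]; no relation between the edges of [H] and those of [G] is
   assumed. Only the values of [P] on [edges H] matter. *)
Definition scheme (H G : sgraph) (f : H -> G) (P : {set H} -> seq G) : Prop :=
  (forall u v : H, adj u v ->
     path_between (f u) (f v) (P [set u; v]) /\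
     [set x in P [set u; v]] :&: f @: [set: H] = [set f u; f v]) /\
  (forall F : {set {set H}}, F \subset edges H -> F != set0 ->
     (exists x : G, forall e, e \in F -> x \in P e) ->
     exists u : H, forall e, e \in F -> u \in e).

Definition rooted_minor (H G : sgraph) (f : H -> G) : Prop :=
  exists C : H -> subgraph G,
    [/\ forall v, connected (C v),
        forall u v, u != v -> [disjoint sub_vertex (C u) & sub_vertex (C v)],
        forall v, f v \in sub_vertex (C v)
      & forall u v, adj u v ->
          exists x y, [/\ x \in sub_vertex (C u), y \in sub_vertex (C v)
                        & adj x y]].

Definition contractible (H : sgraph) : Prop :=
  forall (G : sgraph) (f : H -> G), injective f ->
    (exists P, scheme f P) -> rooted_minor f.

(* Main.v *)
Require Import Defs.
From mathcomp Require Import all_boot.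

(** Repeatedly deleting a vertex of degree at most one orders the vertices of
    the forest so that each has at most one later neighbour, its parent. Going
    through this order, let [C p] be the component of [f p] in the union of
    [{f p}] and the sets [P_pv \ C v] over the children [v] of [p]. Walking
    along [P_pv] from [f p], the first vertex in [C v] is preceded by a vertex
    of [C p], which gives the edge between the two. A common vertex of [C u] and
    [C v], if it is not a root, lies on paths [P_uu'] and [P_vv'] to children
    and outside [C u'] and [C v']. The edges [uu'] and [vv'] share a vertex, and
    [u' = v'] is excluded by uniqueness of parents, so [u = v'] or [v = u'],
    which puts the common vertex in [C v'] or [C u']. *)

Set Implicit Arguments.
Unset Strict Implicit.
Unset Printing Implicit Defensive.

(** Shows later that a walk inside a component uses only edges between vertices of that
    component. *)
Lemma connect_invariant (T : finType) (e : rel T) (x y : T) :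
  connect e x y -> connect [rel a b | connect e x a && e a b] x y.
Proof.
case/connectP=> p + ->; elim/last_ind: p => [|p z IHp] /=; first by rewrite connect0.
rewrite rcons_path last_rcons => /andP[xp pz].
apply: connect_trans (IHp xp) (connect1 _).
by rewrite /= pz andbT; apply/connectP; exists p.
Qed.

(** Recursion along [r]: after [n] iterations of [F], whatever the start [c0], the values at points
    of rank below [n] no longer change. *)
Lemma rank_fixpoint (T : Type) (A : Type) (r : T -> nat) (F : (T -> A) -> T -> A) :
    (forall C D p, (forall v, r v < r p -> C v = D v) -> F C p = F D p) ->
  (T -> A) -> exists C : T -> A, forall p, C p = F C p.
Proof.
move=> F_local c0.
have stable n m p : r p < n -> r p < m -> iter n F c0 p = iter m F c0 p.
  elim: n m p => [//|n IHn] [//|m] p; rewrite !ltnS => pn pm /=.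
  by apply: F_local => v vp; apply: IHn; apply: leq_trans vp _.
exists (fun p => iter (r p).+1 F c0 p) => p /=.
by apply: F_local => v vp; exact: (stable (r p) (r v).+1).
Qed.

Section Graph.

Variable G : sgraph.
Implicit Types (x y : G) (R S : {set G}).

(** The vertex [x] is the first one of a longest path inside [S]: by maximality all its neighbours
    in [S] lie on that path. *)
Lemma forest_leaf S : forest G -> S != set0 ->
  exists2 x, x \in S & {in S &, forall y z, adj x y -> adj x z -> y = z}.
Proof.
move=> forG /set0Pn[x0 x0S].
pose long n := [exists t : n.-tuple G, [&& uniq t, all [in S] t & sorted (@adj G) t]].
have long1 : long 1.
  by apply/existsP; exists [tuple x0]; rewrite /= x0S.
have long_bound n : long n -> n <= #|G|.
  by case/existsP=> t /and3P[/card_uniqP E _ _]; rewrite -[n](size_tuple t) -E max_card.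
case: (ex_maxnP (ex_intro long 1 long1) long_bound) => n /existsP[[s /= /eqP sz]]
  /and3P[us Ss ps] maxn.
case: s sz us Ss ps => [|x q] sz us Ss ps.
  by have := maxn 1 long1; rewrite -sz.
have xS : x \in S by case/andP: Ss.
have nbr_q y : y \in S -> adj x y -> y \in q.
  move=> yS xy; have: y \in x :: q.
    apply: contraT => yq; suff /maxn: long n.+1 by rewrite ltnn.
    apply/existsP; have szy : size [:: y, x & q] == n.+1 by rewrite /= -sz.
    by exists (Tuple szy); move: us Ss ps; rewrite /= yq yS adj_sym xy => -> -> ->.
  by rewrite inE => /orP[/eqP yx|//]; rewrite yx adj_irrefl in xy.
suff nbr_head y : y \in S -> adj x y -> y = head x q.
  by exists x => // y z yS zS xy xz; rewrite (nbr_head y) // (nbr_head z).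
move=> yS xy; have yq := nbr_q y yS xy; apply/eqP/contraT => yh.
(* The edge from [y] back to [x] closes the initial segment ending at [y]. As [y] is not the head of
   [q], [q1] is nonempty, so this cycle has at least three vertices. *)
case: (splitPr yq) us ps yh => q1 q2 us ps yh.
case: (forG (x :: rcons q1 y)).
  by case: q1 yh {us ps} => [|a q1] /=; rewrite ?eqxx ?size_rcons.
move: us ps; rewrite -cat_rcons -cat_cons cat_uniq /= => /andP[uq _].
rewrite cat_path => /andP[pq _].
by rewrite /ucycle /= uq rcons_path pq last_rcons adj_sym xy.
Qed.

(** By induction on a vertex set: a leaf gets rank 0 and all other ranks go up by one, so the leaf
    is never a higher neighbour. A neighbour of higher rank is the parent. *)
Lemma forest_rank : forest G -> exists r : G -> nat, injective r /\
  forall x y z, adj x y -> adj x z -> r x < r y -> r x < r z -> y = z.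
Proof.
move=> forG.
suff [r [rI rP]] : exists r : G -> nat, {in [set: G] &, injective r} /\
    {in [set: G] & &, forall x y z,
      adj x y -> adj x z -> r x < r y -> r x < r z -> y = z}.
  by exists r; split=> [x y|x y z]; [apply: rI|apply: rP]; rewrite inE.
move: [set: G] => S; have [n] := ubnP #|S|.
elim: n S => // n IHn S; rewrite ltnS => Sn.
have [->|S0] := eqVneq S set0.
  by exists (fun=> 0); split=> x y; rewrite inE.
have [v vS vP] := forest_leaf forG S0.
have [|r [rI rP]] := IHn (S :\ v).
  by apply: leq_trans Sn; rewrite [in X in _ < X](cardsD1 v) vS.
exists (fun x => if x == v then 0 else (r x).+1); split=> [x y xS yS|x y z xS yS zS].
  case: eqVneq => [->|xv]; case: eqVneq => [->|yv] // [].
  by apply: rI; rewrite !inE ?xv ?yv.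
have [->|xv] := eqVneq x v; first by move=> xy xz _ _; apply: vP.
case: eqVneq => // yv; case: eqVneq => // zv xy xz; rewrite !ltnS.
by apply: rP xy xz; rewrite !inE ?xv ?yv ?zv.
Qed.

Definition adj_in R : rel G := fun x y => [&& x \in R, y \in R & adj x y].

(** For [x] outside [R] this is the singleton of [x], since [connect] is reflexive. *)
Definition component R x : {set G} := [set y | connect (adj_in R) x y].

Lemma component_root R x : x \in component R x.
Proof. by rewrite inE. Qed.

Lemma component_step R x y z : x \in R ->
  y \in component R x -> z \in R -> adj y z -> z \in component R x.
Proof.
move=> xR; rewrite !inE => xy zR yz; apply: connect_trans (xy) (connect1 _).
rewrite /adj_in zR yz !andbT; case/connectP: xy => p + ->.
by elim/last_ind: p => // p w _; rewrite rcons_path last_rcons => /and3P[_ _ /andP[]].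
Qed.

Lemma component_sub R x : x \in R -> component R x \subset R.
Proof.
move=> xR; apply/subsetP=> y; rewrite inE => /connectP[p + ->].
by elim/last_ind: p => // p w _; rewrite rcons_path last_rcons => /and3P[_ _ /andP[]].
Qed.

Lemma adj_in_sym S : symmetric (adj_in S).
Proof. by move=> x y; rewrite /adj_in adj_sym andbCA. Qed.

Lemma adj_in_vertex S x y : adj_in S x y -> x \in S /\ y \in S.
Proof. by case/and3P. Qed.

Lemma adj_in_adj S x y : adj_in S x y -> adj x y.
Proof. by case/and3P. Qed.

Definition induced S : subgraph G :=
  Subgraph (@adj_in_sym S) (@adj_in_vertex S) (@adj_in_adj S).

Lemma connected_component R x : connected (induced (component R x)).
Proof.
set C := component R x.
have root y : y \in C -> connect (adj_in C) x y.
  rewrite inE => /connect_invariant; apply: connect_sub => a b /andP[xa ab].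
  apply: connect1; have /and3P[_ _ adjab] := ab.
  by rewrite /adj_in adjab andbT !inE xa (connect_trans xa (connect1 ab)).
split=> [|y z yC zC]; first by apply/set0Pn; exists x; apply: component_root.
apply: connect_trans (root z zC).
by rewrite (sym_connect_sym (@adj_in_sym C)) root.
Qed.

Lemma path_from_to_rev x y p : path_from_to x y p -> path_from_to y x (rev p).
Proof.
case=> q [-> xq uq lq]; exists (behead (rev (x :: q))).
have E : rev (x :: q) = y :: behead (rev (x :: q)).
  by rewrite lastI rev_rcons lq.
split=> //; last 2 first.
- by rewrite rev_uniq.
- by rewrite -[LHS]/(last y (y :: behead (rev (x :: q)))) -E rev_cons last_rcons.
have := rev_path (@adj G) x q; rewrite (lastI x q) rev_rcons lq /= => ->.
by rewrite (eq_path (e' := @adj G)) // => a b; rewrite adj_sym.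
Qed.

Lemma component_reach R S x y p : x \in R -> [disjoint component R x & S] ->
    path_from_to x y p -> y \in S -> [set z in p] :\: S \subset R ->
  exists a b, [/\ a \in component R x, b \in S & adj a b].
Proof.
move=> xR dis [q [-> + _ <-]] lS pR.
have {pR} : {subset q <= R :|: S}.
  move=> z zq; rewrite inE orbC; apply/orP; case: (boolP (z \in S)) => zS; first by left.
  by right; apply: (subsetP pR); rewrite !inE zS zq orbT.
(* The current vertex [a] of the walk is generalized, while the component stays that of [x]. *)
elim: q {1 3 4}x (component_root R x) lS => [|b q IHq] a aC /=.
  by move=> aS; rewrite (disjointFr dis aC) in aS.
move=> lS qR /andP[ab bq].
have [bS|bS] := boolP (b \in S); first by exists a, b.
apply: (IHq b) => // [|z zq]; last by rewrite qR // inE zq orbT.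
by apply: component_step xR aC _ ab; have := qR b (mem_head _ _); rewrite inE (negPf bS) orbF.
Qed.

End Graph.

Theorem corollary3p5 (H : sgraph) : forest H -> contractible H.
Proof.
move=> /forest_rank[r [rI parentU]] G f fI [P [Ppath Pstar]].
pose child p v := adj p v && (r v < r p).
pose region (C : H -> {set G}) p :=
  f p |: \bigcup_(v | child p v) ([set x in P [set p; v]] :\: C v).
(* [region C p] consults [C] only at children of [p], which have lower rank. *)
have [C CE] : exists C : H -> {set G}, forall p, C p = component (region C p) (f p).
  apply: (rank_fixpoint (r := r) (F := fun C p => component (region C p) (f p)));
    last by move=> _; exact: set0.
  move=> C D p CD; congr (component (_ |: _) _); apply: eq_bigr => v /andP[_ vp].
  by rewrite CD.
have fR v : f v \in region C v by rewrite !inE eqxx.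
have fC v : f v \in C v by rewrite CE component_root.
have regionP p z : z \in C p -> z = f p \/
    exists v, [/\ child p v, z \in P [set p; v] & z \notin C v].
  rewrite CE => /(subsetP (component_sub (fR p))); rewrite inE => /orP[/set1P->|]; first by left.
  by case/bigcupP=> v pv; rewrite !inE => /andP[zC zP]; right; exists v.
have P_root u v w : adj u v -> f w \in P [set u; v] -> w = u \/ w = v.
  move=> /Ppath[_ /setP/(_ (f w))]; rewrite !inE !(inj_eq fI) => + wP.
  by rewrite wP imset_f ?inE //= => /esym/orP[]/eqP; [left|right].
(* A scheme path meets the roots only at its ends, so a foreign root in [C v] would be [f w] for a
   child [w] of [v]; but [f w] lies in the removed set [C w]. *)
have root_notin u v : u != v -> f u \notin C v.
  move=> uv; apply/negP => /regionP[/fI/eqP|[w [/andP[vw _] /(P_root _ _ _ vw)]]].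
    by rewrite (negPf uv).
  by case=> E; move: uv; rewrite E ?eqxx // fC.
have dis u v : u != v -> [disjoint C u & C v].
  move=> uv; apply/pred0P => z; apply/negP => /andP[/= zu zv].
  have [zE|[u' [uu' zPu zNu]]] := regionP u z zu.
    by move: zv; rewrite zE (negPf (root_notin _ _ uv)).
  have [zE|[v' [vv' zPv zNv]]] := regionP v z zv.
    by move: zu; rewrite zE (negPf (root_notin _ _ _)) // eq_sym.
  have [/andP[auu' ru] /andP[avv' rv]] := (uu', vv').
  have [|||t tF] := Pstar [set [set u; u']; [set v; v']].
  - apply/subsetP=> e /set2P[]->; rewrite inE; apply/existsP.
      by exists u; apply/existsP; exists u'; rewrite auu' /=.
    by exists v; apply/existsP; exists v'; rewrite avv' /=.
  - by apply/set0Pn; exists [set u; u']; rewrite set21.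
  - by exists z => e /set2P[]->.
  have /set2P tu := tF _ (set21 _ _); have /set2P tv := tF _ (set22 _ _).
  case: tu tv => -> [] E.
  - by rewrite E eqxx in uv.
  - by rewrite -E zu in zNv.
  - by rewrite E zv in zNu.
  - move: uv; rewrite (parentU u' u v) ?eqxx // 1?adj_sym // E //.
have reach p v : child p v ->
    exists a b, [/\ a \in C p, b \in C v & adj a b].
  move=> pv; have /andP[apv rpv] := pv.
  have disp : [disjoint component (region C p) (f p) & C v].
    by rewrite -CE dis //; apply: contraTneq rpv => ->; rewrite ltnn.
  have sub : [set x in P [set p; v]] :\: C v \subset region C p.
    by apply: subsetU; rewrite (bigcup_sup v) ?orbT.
  (* The path may be listed from [f v]; it is then reversed so that the walk starts at [f p]. *)
  rewrite [C p]CE; have [[Pp|/path_from_to_rev Pp] _] := Ppath p v apv.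
    exact: component_reach Pp (fC v) sub.
  apply: component_reach Pp (fC v) _ => //.
  by apply: subset_trans sub; apply: setSD; apply/subsetP=> z; rewrite !inE mem_rev.
exists (fun v => induced (C v)); split=> //= [v|u v uv].
  by rewrite CE; apply: connected_component.
(* The end of lower rank is the child of the other, and injectivity of [r] rules out a tie. *)
have [ruv|ruv|/rI E] := ltngtP (r u) (r v).
- have [|a [b [aC bC ab]]] := reach v u; first by rewrite /child adj_sym uv.
  by exists b, a; rewrite adj_sym.
- by apply: reach; rewrite /child uv.
- by rewrite E adj_irrefl in uv.
Qed.
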